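(* Let $\Gamma$ be a connected trivalent graph and let $G\le\mathrm{Aut}(\Gamma)$ act vertex- and edge-transitively, but not arc-transitively, on $\Gamma$, with infinite vertex stabilizers. Then $\Gamma$ is a tree. Furthermore, let $\Gamma_+$ be the digraph with the same vertex set as $\Gamma$ whose arc set is one of the orbits of $G$ on the arcs of $\Gamma$. Then $G$ acts highly-arc-transitively on $\Gamma_+$. In particular, $G$ fixes an end $\omega$ of $\Gamma$, and if $G$ is a closed subgroup of $\mathrm{Aut}(\Gamma)$, then $G$ acts transitively on the set of ends of $\Gamma$ other than $\omega$.
   Context: Graphs are simple. An arc of a graph is an ordered pair $(\alpha,\beta)$ with $\{\alpha,\beta\}$ an edge. In a digraph (a set of vertices with a set of arcs, i.e. ordered pairs of distinct vertices), an $s$-arc is a tuple $(\alpha_0,\dots,\alpha_s)$ with each $(\alpha_i,\alpha_{i+1})$ an arc and $\alpha_{i-1}\neq\alpha_{i+1}$ for $1\le i\le s-1$; a group acts highly-arc-transitively on a digraph if it acts transitively on its set of $s$-arcs for every $s\ge 0$. A sequence of permutations $g_i$ converges to $g$ if for each point $\alpha$, $\alpha g_i=\alpha g$ for all large $i$; a permutation group is closed if it contains limits of convergent sequences of its elements. Ends: equivalence classes of rays (one-way infinite paths of distinct vertices), two rays being equivalent if some third ray meets both in infinitely many vertices. *)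

(* Defs.v *)
From mathcomp Require Import all_boot.
From mathcomp Require Import all_classical.

Set Implicit Arguments.
Unset Strict Implicit.
Unset Printing Implicit Defensive.

Local Open Scope classical_set_scope.
Local Open Scope card_scope.

Section Graphs.
Variables (V : choiceType) (e : rel V).

Definition simple_graph : Prop := symmetric e /\ irreflexive e.

(* A connected graph is required to have a vertex. *)
Definition connected_graph : Prop :=
  [set: V] !=set0 /\
  forall x y, exists p : seq V, path e x p /\ last x p = y.

Definition trivalent : Prop := forall x, [set y | e x y] #= `I_3.

Definition acyclic_graph : Prop :=
  forall c : seq V, 2 < size c -> ~ ucycle e c.

Definition tree : Prop := connected_graph /\ acyclic_graph.

Definition aut : set (V -> V) :=
  [set g | bijective g /\ forall x y, e (g x) (g y) = e x y].

Definition arcs : set (V * V) := [set a | e a.1 a.2].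

Definition edges : set (set V) := [set [set a.1; a.2] | a in arcs].

End Graphs.

Section Groups.
Variable V : choiceType.
Implicit Types (e : rel V) (G : set (V -> V)).

Definition aut_subgroup e G : Prop :=
  [/\ G `<=` aut e,
      G id,
      (forall g h, G g -> G h -> G (g \o h)) &
      (forall g, G g -> exists h, [/\ G h, cancel g h & cancel h g])].

Definition stab G x : set (V -> V) := [set g | G g /\ g x = x].

Definition on_arc (g : V -> V) (a : V * V) : V * V := (g a.1, g a.2).

Definition vertex_transitive G : Prop :=
  forall x y, exists2 g, G g & g x = y.

Definition edge_transitive e G : Prop :=
  forall E F, edges e E -> edges e F -> exists2 g, G g & g @` E = F.

Definition arc_transitive e G : Prop :=
  forall a b, arcs e a -> arcs e b -> exists2 g, G g & on_arc g a = b.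

Definition arc_orbit e G (A : set (V * V)) : Prop :=
  exists2 a, arcs e a & A = [set on_arc g a | g in G].

(* A digraph on V is given by its set of arcs A. *)
Definition s_arc (A : set (V * V)) s (t : s.+1.-tuple V) : Prop :=
  (forall i j : 'I_s.+1, j = i.+1 :> nat -> A (tnth t i, tnth t j)) /\
  (forall i j : 'I_s.+1, j = i.+2 :> nat -> tnth t i <> tnth t j).

Definition highly_arc_transitive (A : set (V * V)) G : Prop :=
  forall s (t u : s.+1.-tuple V),
    s_arc A t -> s_arc A u -> exists2 g, G g & map_tuple g t = u.

Definition converges_to (gs : nat -> V -> V) (g : V -> V) : Prop :=
  forall x, exists N, forall n, N <= n -> gs n x = g x.

Definition closed_group G : Prop :=
  forall gs g, (forall n, G (gs n)) -> bijective g -> converges_to gs g -> G g.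

End Groups.

Section Ends.
Variables (V : choiceType) (e : rel V).

Definition ray (r : nat -> V) : Prop :=
  injective r /\ forall n, e (r n) (r n.+1).

Definition ray_equiv (r s : nat -> V) : Prop :=
  exists t, [/\ ray t, infinite_set (range t `&` range r)
              & infinite_set (range t `&` range s)].

Definition graph_end (w : set (nat -> V)) : Prop :=
  exists2 r, ray r & w = [set s | ray s /\ ray_equiv r s].

Definition on_end (g : V -> V) (w : set (nat -> V)) : set (nat -> V) :=
  [set g \o r | r in w].

End Ends.

(* Main.v *)
Require Import Defs.
From mathcomp Require Import all_boot.
From mathcomp Require Import finmap all_classical zify.

Set Implicit Arguments.
Unset Strict Implicit.
Unset Printing Implicit Defensive.

Local Open Scope classical_set_scope.
Local Open Scope card_scope.

(** Since [G] is not arc-transitive, exactly one orientation of each edge lies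
    in a given arc orbit, so every vertex has in- and out-valencies 1 and 2 in
    one order or the other.  Up to reversing the orientation, each vertex has a
    unique parent and two children, and [Γ] is the graph of the parent map [p],
    which commutes with [G].  A vertex determines its ancestors, so vertex-
    transitivity already gives transitivity on [s]-arcs.  If [p^n] fixed one
    vertex it would fix all of them, making [p] injective; hence [p] has no
    periodic point and [Γ] is a tree.  A ray either climbs through the iterated
    parents, and all such rays lie in one end [ω], or descends from some point
    on.  Given two descending rays [a] and [b], take [g_k] in [G] mapping
    [a k] to [b k], hence [a i] to [b i] for [i <= k]; by local finiteness the
    [g_k] accumulate at an element of a closed [G], which maps [a] to [b]. *)

(** * Compactness of closed groups of automorphisms *)

Section LocallyFinite.
Variables (V : choiceType) (e : rel V).
Hypothesis e_conn : connected_graph e.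
Hypothesis e_fin : forall x, finite_set [set y | e x y].

Lemma finite_walk_ends n x :
  finite_set [set y | exists q, [/\ size q = n, path e x q & last x q = y]].
Proof.
elim: n x => [|n IHn] x.
  apply: (@sub_finite_set _ _ [set x]) => [y [q [/size0nil -> _ <-]]//|].
  exact: finite_set1.
apply: (@sub_finite_set _ _ (\bigcup_(z in [set z | e x z])
   [set y | exists q, [/\ size q = n, path e z q & last z q = y]])).
  move=> y [[|z q] [//= [sq] /andP[exz pq] lq]].
  by exists z => //; exists q.
by apply: bigcup_finite.
Qed.

(** Induction on an enumeration of [S]: either the fibre over its head or the complement of that
    fibre belongs to [U]. *)
Lemma ultra_finite (T : Type) (U : set_system T) (h : T -> V) (S : set V) :
  UltraFilter U -> finite_set S -> U (h @^-1` S) ->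
  exists y, U (h @^-1` [set y]).
Proof.
move=> UU /finite_seqP[s ->]; elim: s => [|y s IHs] Us.
  have : U set0 by apply: filterS Us.
  by move/filter_not_empty.
have [Uy|Uny] := in_ultra_setVsetC (h @^-1` [set y]) UU; first by exists y.
apply: IHs; apply: filterS2 Us Uny => k /=.
by rewrite inE => /orP[/eqP|].
Qed.

(** The limit is taken along an ultrafilter containing all tails: each [gs k x] stays at bounded
    distance from [y0], hence is constant on a member of [U]. *)
Lemma closed_group_cluster (G : set (V -> V)) (gs : nat -> V -> V) x0 y0 :
  aut_subgroup e G -> closed_group G ->
  (forall k, G (gs k)) -> (forall k, gs k x0 = y0) ->
  exists2 g, G g &
    forall x y, (exists N, forall k, N <= k -> gs k x = y) -> g x = y.
Proof.
move=> [Gaut _ _ Ginv] Gcl Ggs gs0.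
have [U [UU ooU]] := ultraFilterLemma eventually_filter.
have UoN N : U [set k | N <= k] by apply: ooU; exists N.
have Uex A : U A -> exists k, A k by move/filter_ex.
have mapw f x y z q : (forall u v, e (f u) (f v) = e u v) -> f x = y ->
    path e x q -> last x q = z ->
    exists q', [/\ size q' = size q, path e y q' & last y q' = f z].
  move=> fe <- pq <-; exists (map f q); rewrite size_map last_map; split=> //.
  by rewrite path_map; apply: sub_path pq => u v /=; rewrite fe.
have lim x : exists y, U [set k | gs k x = y].
  have [q [pq lq]] := e_conn.2 x0 x.
  apply: (@ultra_finite _ _ (gs^~ x) _ UU (finite_walk_ends (size q) y0)).
  apply: filterS filterT => k _ /=.
  by apply: mapw (gs0 k) pq lq; exact: (Gaut _ (Ggs k)).2.
have [g gP] := choice lim.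
have gN x y N : (forall k, N <= k -> gs k x = y) -> g x = y.
  move=> Nk; have [k [/= <- /Nk <-]//] := Uex _ (filterI (gP x) (UoN N)).
have ginj : injective g.
  move=> x y gxy; have [k [/= kx ky]] := Uex _ (filterI (gP x) (gP y)).
  by apply: (bij_inj (Gaut _ (Ggs k)).1); rewrite kx ky.
have gsurj y : exists x, g x = y.
  (* Surjectivity may be lost in a pointwise limit, so the inverses need limits too; these exist
     because every [hs k] sends [y0] to [x0]. *)
  have inv k : exists h, [/\ G h, cancel (gs k) h & cancel h (gs k)].
    exact: Ginv.
  have [hs hsP] := choice inv.
  have [q [pq lq]] := e_conn.2 y0 y.
  have [x Ux] : exists x, U ((hs^~ y) @^-1` [set x]).
    apply: (@ultra_finite _ _ _ _ UU (finite_walk_ends (size q) x0)).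
    apply: filterS filterT => k _ /=.
    have [Gh gh hg] := hsP k.
    by apply: mapw pq lq; [exact: (Gaut _ Gh).2 | rewrite -(gs0 k)].
  exists x; have [k [/= kx hk]] := Uex _ (filterI (gP x) Ux).
  by rewrite -kx -hk; have [_ _ ->] := hsP k.
have gbij : bijective g.
  have [h hP] := choice gsurj; exists h => // x; exact/ginj.
(* [closed_group] speaks of sequences: [ks n] will be an index at which [gs] agrees with [g] on the
   ball of radius [n] about [x0]. *)
pose B n := \bigcup_(i in `I_n.+1)
   [set y | exists q, [/\ size q = i, path e x0 q & last x0 q = y]].
have Bfin n : finite_set (B n).
  by apply: bigcup_finite => // i _; exact: finite_walk_ends.
have agree (S : set V) : finite_set S ->
    U [set k | forall x, S x -> gs k x = g x].
  move=> /finite_seqP[s ->]; elim: s => [|y s IHs].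
    by apply: filterS filterT.
  apply: filterS2 IHs (gP y) => k /= IH ky x; rewrite inE => /orP[/eqP->//|].
  exact: IH.
have sub n : exists k, forall x, B n x -> gs k x = g x.
  exact: Uex (agree _ (Bfin n)).
have [ks ksP] := choice sub.
exists g; last by move=> x y [N]; exact: gN.
apply: (Gcl (fun n => gs (ks n))) => // x.
have [q [pq lq]] := e_conn.2 x0 x.
by exists (size q) => n qn; apply: ksP; exists (size q);
  [rewrite /= ltnS | exists q].
Qed.

End LocallyFinite.

(** * Graphs of aperiodic maps *)

Section ParentMap.
Variables (V : choiceType) (e : rel V) (p : V -> V).
Hypothesis eP : forall x y, e x y <-> p x = y \/ p y = x.
Hypothesis p_aper : forall x n, iter n.+1 p x <> x.

Definition ascending (r : nat -> V) := forall n, r n = iter n p (r 0).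
Definition descending_from N (r : nat -> V) :=
  forall n, N <= n -> p (r n.+1) = r n.

Lemma iter_parent_inj x m n : iter m p x = iter n p x -> m = n.
Proof.
wlog lt_mn : m n / m < n.
  by case: (ltngtP m n) => // lt W xmn; [apply: W | symmetry; apply: W].
move=> xmn; case: (@p_aper (iter m p x) (n - m).-1).
by rewrite prednK ?subn_gt0// -iterD subnK 1?ltnW.
Qed.

(* Once a walk without backtracking goes down it cannot turn up again, as the
   only way up is the one it came from. *)
Lemma walk_ascending_or_descending (w : nat -> V) :
  (forall i, e (w i) (w i.+1)) -> (forall i, w i <> w i.+2) ->
  ascending w \/ exists N, descending_from N w.
Proof.
move=> we wnb; have [[N wN]|up] := pselect (exists N, p (w N.+1) = w N).
  right; exists N => n /subnK <-; elim: (n - N) => // k.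
  rewrite addSn; move: (k + N) => i IHi.
  case: ((eP _ _).1 (we i.+1)) => // wi.
  by case: (wnb i); rewrite -IHi -wi.
left; elim=> // n IHn; rewrite iterS -IHn.
by case: ((eP _ _).1 (we n)) => [->|wn]//; case: up; exists n.
Qed.

Lemma iter_descending N r n k :
  descending_from N r -> N <= n -> iter k p (r (n + k)) = r n.
Proof.
move=> rN Nn; elim: k => [|k IHk]; first by rewrite addn0.
by rewrite iterSr addnS rN // (leq_trans Nn) // leq_addr.
Qed.
Arguments iter_descending {N r} n k _ _.

(** A cycle unrolls into a periodic walk, which does not backtrack because its more than two
    vertices are distinct. Such a walk ends up going one way only, so its period contradicts
    [p_aper]. *)
Lemma acyclic_parent : acyclic_graph e.
Proof.
case=> // x s; set c := x :: s; set n := size c => n2 /andP[ce cu].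
pose w i := nth x c (i %% n).
have n0 : 0 < n by [].
have wper i : w (i + n) = w i by rewrite /w modnDr.
have we i : e (w i) (w i.+1).
  have /(pathP x)/(_ (i %% n)) : path e x (rcons s x) by [].
  rewrite size_rcons ltn_mod => /(_ n0).
  rewrite -rcons_cons !nth_rcons_default /w modnS.
  (* If [n] divides [i.+1], the index is [size s], and the default value [x] of [nth] closes the
     cycle. *)
  case: ifP => // /dvdnP[q iq]; suff -> : i %% n = n.-1.
    by rewrite (@nth_default _ x s).
  case: q iq => // q iq; have -> : i = q * n + n.-1 by move: iq n0; nia.
  by rewrite modnMDl modn_small// prednK.
have wnb i : w i <> w i.+2.
  move=> /eqP; rewrite nth_uniq ?ltn_mod// -addn2 -{1}[i]addn0 eqn_modDl.
  by rewrite mod0n modn_small.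
case: (walk_ascending_or_descending we wnb) => [up|[N dn]].
  by apply: (@p_aper (w 0) n.-1); rewrite prednK// -up -[n]add0n wper.
apply: (@p_aper (w N) n.-1); rewrite prednK//.
by rewrite -{1}wper (iter_descending N n dn).
Qed.

Lemma ray_ascending_or_descending r :
  ray e r -> ascending r \/ exists N, descending_from N r.
Proof.
move=> [rinj re]; apply: walk_ascending_or_descending => // i /rinj.
by lia.
Qed.

Lemma ray_iter x : ray e (fun n => iter n p x).
Proof. by split=> [m n /iter_parent_inj//|n]; apply/eP; left. Qed.

Lemma ray_shift r m : ray e r -> ray e (fun k => r (m + k)).
Proof.
by move=> [rinj re]; split=> [i j /rinj /addnI//|n]; rewrite addnS.
Qed.

(** * Ends as classes of rays with a common tail *)

Hypothesis e_conn : connected_graph e.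

(** Induction on a walk from [x] to [y]: a first step up costs one more iterate at [x], a first step
    down one more at [y]. *)
Lemma common_ancestor x y : exists m n, iter m p x = iter n p y.
Proof.
have [q [pq lq]] := e_conn.2 x y.
elim: q x pq lq => [|z q IHq] x /=; first by move=> _ <-; exists 0, 0.
move=> /andP[exz pq] lq; have [m [n zy]] := IHq z pq lq.
case: ((eP _ _).1 exz) => [xz|zx].
  by exists m.+1, n; rewrite iterSr xz.
by exists m, n.+1; rewrite iterS -zy -iterS iterSr zx.
Qed.

(** For rays this amounts to [ray_equiv], but here transitivity is immediate. *)
Definition tail_equiv (r s : nat -> V) :=
  exists m n, forall k, r (m + k) = s (n + k).

Lemma tail_equiv_sym r s : tail_equiv r s -> tail_equiv s r.
Proof. by move=> [m [n rs]]; exists n, m. Qed.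

Lemma tail_equiv_trans r s t :
  tail_equiv r s -> tail_equiv s t -> tail_equiv r t.
Proof.
move=> [m [n rs]] [m' [n' st]]; exists (m + m'), (n' + n) => k.
by rewrite -!addnA rs addnCA st.
Qed.

Lemma tail_equiv_shift r m : tail_equiv r (fun k => r (m + k)).
Proof. by exists m, 0. Qed.

Lemma ascending_tail_equiv r s : ascending r -> ascending s -> tail_equiv r s.
Proof.
move=> rup sup; have [m [n rs]] := common_ancestor (r 0) (s 0).
exists m, n => k.
by rewrite rup sup addnC iterD rs -iterD addnC.
Qed.

Lemma infinite_meet (T : Type) (r s : nat -> T) N M :
  infinite_set (range r `&` range s) ->
  exists i j, [/\ N <= i, M <= j & r i = s j].
Proof.
apply: contra_notP => no.
apply: (@sub_finite_set _ _ (r @` `I_N `|` s @` `I_M)).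
  move=> x [[i _ <-] [j _ sr]].
  have [Ni|Ni] := leqP N i; last by left; exists i.
  have [Mj|Mj] := leqP M j; last by right; exists j.
  by case: no; exists i, j.
by rewrite finite_setU; split; exact: finite_image.
Qed.

(** If [r i = s j] with [N <= j], climbing to [s N] shows it to be the [i + (j - N)]-th iterated
    parent of [r 0]; aperiodicity fixes this number and so bounds [i]. *)
Lemma infinite_meet_not_ascending_descending r s N :
  ascending r -> descending_from N s -> ~ infinite_set (range r `&` range s).
Proof.
move=> rup sdn inf.
have key i j : N <= j -> r i = s j -> iter (i + (j - N)) p (r 0) = s N.
  move=> Nj rs; rewrite addnC iterD -rup rs -{2}(subnKC Nj).
  by rewrite (iter_descending _ _ sdn).
have [i [j [_ Nj /key]]] := infinite_meet 0 N inf; move/(_ Nj).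
set M := i + _ => rM.
have [i' [j' [Mi' Nj' /key]]] := infinite_meet M.+1 N inf; move/(_ Nj').
by rewrite -rM => /iter_parent_inj; lia.
Qed.

(** Two descending rays that meet, and meet again further down, agree in between because parents are
    unique. *)
Lemma infinite_meet_tail_equiv r s :
  ray e r -> ray e s -> infinite_set (range r `&` range s) -> tail_equiv r s.
Proof.
move=> rr rs inf.
case: (ray_ascending_or_descending rr) (ray_ascending_or_descending rs).
  move=> rup [|[N sdn]]; first exact: ascending_tail_equiv.
  by case: (infinite_meet_not_ascending_descending rup sdn).
move=> [N rdn] [sup|[M sdn]].
  rewrite setIC in inf.
  by case: (infinite_meet_not_ascending_descending sup rdn).
have [i [j [Ni Mj rsij]]] := infinite_meet N M inf.
exists i, j => k.
have [i' [j' [ii' jj' rsij']]] := infinite_meet (i + k) (j + k) inf.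
have ii0 : i' = i + (i' - i) by lia.
have jj0 : j' = j + (j' - j) by lia.
(* From [r i' = s j'] both climbs end at the same vertex [r i = s j], so they have equal length. *)
have di : i' - i = j' - j.
  apply: (@iter_parent_inj (r i')).
  rewrite {2}ii0 (iter_descending _ _ rdn)// rsij rsij' {2}jj0.
  by rewrite (iter_descending _ _ sdn).
rewrite -(iter_descending (i + k) (i' - (i + k)) rdn); last by lia.
rewrite -(iter_descending (j + k) (j' - (j + k)) sdn); last by lia.
by rewrite !subnKC// rsij'; congr iter; lia.
Qed.

Lemma ray_equivE r s : ray e r -> ray e s -> ray_equiv e r s <-> tail_equiv r s.
Proof.
move=> rr rs; split=> [[t [rt tr ts]]|[m [n mn]]].
  apply: tail_equiv_trans (infinite_meet_tail_equiv rt rs ts).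
  exact/tail_equiv_sym/infinite_meet_tail_equiv.
have inf (A : set V) : (forall k, A (r (m + k))) -> infinite_set A.
  move=> Ar; apply/infiniteP.
  rewrite -(card_le_eql (@inj_card_eq _ _ [set: nat] (fun k => r (m + k)) _)).
    by apply: subset_card_le => _ [k _ <-].
  by apply: in2W => i j /rr.1 /addnI.
(* [r] itself serves as the third ray. *)
exists r; split=> //; apply: inf => k; split; try by exists (m + k).
by rewrite mn; exists (n + k).
Qed.

Definition end_of (r : nat -> V) : set (nat -> V) :=
  [set s | ray e s /\ ray_equiv e r s].

Lemma eq_end_of r s :
  ray e r -> ray e s -> tail_equiv r s -> end_of r = end_of s.
Proof.
move=> rr rs eqrs; apply/seteqP; split=> t [rt /ray_equivE et]; split=> //;
    apply/ray_equivE => //.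
  exact: tail_equiv_trans (tail_equiv_sym eqrs) (et rr rt).
exact: tail_equiv_trans eqrs (et rs rt).
Qed.

Lemma aut_ray g r : aut e g -> ray e r -> ray e (g \o r).
Proof.
move=> [gb ge] [rinj re]; split; last by move=> n /=; rewrite ge.
exact: inj_comp (bij_inj gb) rinj.
Qed.

Lemma on_end_of g h r : aut e g -> aut e h -> cancel h g -> ray e r ->
  on_end g (end_of r) = end_of (g \o r).
Proof.
move=> ag ah hg rr; have gr := aut_ray ag rr; apply/seteqP; split.
  move=> _ [s [rs /ray_equivE-/(_ rr rs) [m [n mn]]] <-].
  split; first exact: aut_ray.
  by apply/ray_equivE => //; [exact: aut_ray | exists m, n => k /=; rewrite mn].
move=> s [rs /ray_equivE-/(_ gr rs) [m [n mn]]].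
have hs := aut_ray ah rs.
exists (h \o s); last by apply: funext => k /=; rewrite hg.
split=> //; apply/ray_equivE => //; exists m, n => k /=.
by rewrite -mn /=; apply: (bij_inj ag.1); rewrite hg.
Qed.

End ParentMap.

(** * The parent map of an arc orbit *)

Section ArcOrbit.
Variables (V : choiceType) (e : rel V) (G : set (V -> V)).
Hypothesis e_simple : simple_graph e.
Hypothesis e_trivalent : trivalent e.
Hypothesis G_aut : aut_subgroup e G.
Hypothesis G_vertex : vertex_transitive G.
Hypothesis G_edge : edge_transitive e G.
Hypothesis G_not_arc : ~ arc_transitive e G.

Lemma trivalent_neighbours x : exists a b c,
  [/\ a <> b, a <> c, b <> c & forall y, e x y <-> y = a \/ y = b \/ y = c].
Proof.
have /finite_fsetP[X eX] : finite_set [set y | e x y].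
  by apply/finite_setP; exists 3.
have : [set` X] #= `I_3 by rewrite -eX; exact: e_trivalent.
move=> /card_eq_fsetP sX; have := fset_uniq X.
have XP y : e x y <-> y \in (X : seq V).
  by rewrite -[is_true (e x y)]/([set y | e x y] y) eX.
move: sX XP.
case: (X : seq V) => [|a [|b [|c [|]]]]//= _ XP.
rewrite !inE negb_or andbT => /andP[/andP[/eqP ab /eqP ac] /eqP bc].
exists a, b, c; split=> // y; rewrite XP !inE; split.
  by case/or3P=> /eqP; auto.
by case=> [->|[->|->]]; rewrite eqxx ?orbT.
Qed.

(** The last clause, a vertex with two children, is what rules out periodic points. *)
Definition is_parent_map (p : V -> V) : Prop :=
  [/\ forall g x, G g -> g (p x) = p (g x),
      forall x y, e x y <-> p x = y \/ p y = x &
      exists x y, x <> y /\ p x = p y].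

(** [B u v] is read as: [u] is the parent of [v]. The unique parent at [x0] is carried to every
    vertex by [G]. *)
Lemma invariant_parent_map (B : V -> V -> Prop) x0 z v1 v2 :
  (forall g u v, G g -> B u v -> B (g u) (g v)) ->
  (forall u v, e u v <-> B u v \/ B v u) ->
  (forall u, B u x0 <-> u = z) -> v1 <> v2 -> B x0 v1 -> B x0 v2 ->
  exists p, is_parent_map p /\ forall u v, B u v <-> p v = u.
Proof.
move=> BG eB Bz v12 B1 B2; have [Ga _ _ Ginv] := G_aut.
have par x : exists y, forall u, B u x <-> u = y.
  have [g Gg <-] := G_vertex x0 x; exists (g z) => u.
  have [h [Gh gh hg]] := Ginv _ Gg.
  split=> [/(BG h _ _ Gh)|->]; last by apply: BG => //; apply/Bz.
  by rewrite gh => /Bz <-; rewrite hg.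
have [p pP] := choice par; exists p.
have Bp u v : B u v <-> p v = u by rewrite pP.
split=> //; split.
- by move=> g x Gg; apply/esym/Bp/BG/Bp.
- by move=> x y; rewrite eB !Bp; split=> -[]; auto.
- by exists v1, v2; split=> //; transitivity x0; [|symmetry]; apply/Bp.
Qed.

(** In- and out-neighbours split the three neighbours of a vertex as 1 + 2 or 2 + 1. The lone one is
    the parent, and the final disjunction records the orientation of [A]. *)
Lemma arc_orbit_parent_map A : arc_orbit e G A -> exists p, is_parent_map p /\
  ((forall u v, A (u, v) <-> p v = u) \/ (forall u v, A (u, v) <-> p u = v)).
Proof.
move=> [[a b] /= eab AE]; have [Ga Gid Gcomp Ginv] := G_aut.
have [esym eirr] := e_simple.
have AP u v : A (u, v) <-> exists g, [/\ G g, g a = u & g b = v].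
  by rewrite AE; split=> [[g Gg [<- <-]]|[g [Gg <- <-]]]; exists g.
have AG g u v : G g -> A (u, v) -> A (g u, g v).
  move=> Gg /AP[h [Gh <- <-]]; apply/AP; exists (g \o h); split=> //.
  exact: Gcomp.
have Aab : A (a, b) by apply/AP; exists id.
have Ae u v : A (u, v) -> e u v.
  by move=> /AP[g [/Ga[_ ge] <- <-]]; rewrite ge.
have eA u v : e u v -> A (u, v) \/ A (v, u).
  move=> euv; have [||g Gg gE] := @G_edge [set a; b] [set u; v].
  - by exists (a, b).
  - by exists (u, v).
  have ga : [set u; v] (g a) by rewrite -gE; exists a => //; left.
  have gb : [set u; v] (g b) by rewrite -gE; exists b => //; right.
  have : e (g a) (g b) by rewrite (Ga _ Gg).2.
  case: ga => ga; case: gb => gb; rewrite ga gb ?eirr// => _.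
  - by left; apply/AP; exists g.
  - by right; apply/AP; exists g.
(* An arc of [A] with its reverse in [A] would put [(b, a)], hence every arc, into the single orbit
   [A]. *)
have Aasym u v : A (u, v) -> ~ A (v, u).
  move=> Auv Avu; apply: G_not_arc.
  have Aba : A (b, a).
    have /AP[g [Gg gu gv]] := Auv; have [h [Gh gh hg]] := Ginv _ Gg.
    by have := AG h _ _ Gh Avu; rewrite -gu -gv !gh.
  have allA x y : e x y -> A (x, y).
    by case/eA => // /AP[g [Gg <- <-]]; apply: AG.
  move=> [x y] [x' y'] /allA/AP[g [Gg ga gb]] /allA/AP[g' [Gg' ga' gb']].
  have [h [Gh gh hg]] := Ginv _ Gg; exists (g' \o h); first exact: Gcomp.
  by move: ga gb ga' gb' => /= <- <- ga' gb'; rewrite /on_arc /= !gh ga' gb'.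
have eAP u v : e u v <-> A (u, v) \/ A (v, u).
  by split=> [/eA//|[/Ae//|/Ae]]; rewrite esym.
(* An arc of [A] enters [a] and [(a, b)] leaves it, which excludes the splits 0 + 3 and 3 + 0. *)
have [g Gg gba] := G_vertex b a.
have Aza : A (g a, a) by rewrite -{2}gba; exact: AG.
have [n1 [n2 [n3 [n12 n13 n23 nP]]]] := trivalent_neighbours a.
have nA u : u = n1 \/ u = n2 \/ u = n3 <-> A (a, u) \/ A (u, a).
  by rewrite -nP eAP.
pose star (B : V -> V -> Prop) := exists z v1 v2,
  [/\ forall u, B u a <-> u = z, v1 <> v2, B a v1 & B a v2].
have dich : star (fun u v => A (u, v)) \/ star (fun u v => A (v, u)).
  have cl n : n = n1 \/ n = n2 \/ n = n3 ->
      A (a, n) /\ ~ A (n, a) \/ A (n, a) /\ ~ A (a, n).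
    move=> /nA[Aan|Ana].
    + by left; split=> //; apply: Aasym.
    + by right; split=> //; apply: Aasym.
  have st (B : V -> V -> Prop) z v1 v2 :
      (forall u, B u a -> u = z \/ u = v1 \/ u = v2) ->
      v1 <> v2 -> B z a -> ~ B v1 a -> ~ B v2 a -> B a v1 -> B a v2 -> star B.
    move=> Bn v12 Bz nB1 nB2 B1 B2; exists z, v1, v2; split=> // u.
    by split=> [Bu|->//]; case: (Bn u Bu) => // -[] E;
      [case: nB1|case: nB2]; rewrite -E.
  have inN u : A (u, a) -> u = n1 \/ u = n2 \/ u = n3.
    by move=> Aua; apply/nA; right.
  have outN u : A (a, u) -> u = n1 \/ u = n2 \/ u = n3.
    by move=> Aau; apply/nA; left.
  have := outN _ Aab; have := inN _ Aza.
  have [] := cl n1 (or_introl erefl);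
    have [] := cl n2 (or_intror (or_introl erefl));
    have [] := cl n3 (or_intror (or_intror erefl));
    move=> [h3 h3'] [h2 h2'] [h1 h1'] zn bn.
  - by case: zn => [|[]] zn; move: Aza; rewrite zn.
  - left; apply: (st _ n3 n1 n2) => // u /inN; tauto.
  - left; apply: (st _ n2 n1 n3) => // u /inN; tauto.
  - right; apply: (st _ n1 n2 n3) => // u /outN; tauto.
  - left; apply: (st _ n1 n2 n3) => // u /inN; tauto.
  - right; apply: (st _ n2 n1 n3) => // u /outN; tauto.
  - right; apply: (st _ n3 n1 n2) => // u /outN; tauto.
  - by case: bn => [|[]] bn; move: Aab; rewrite bn.
case: dich => -[z [v1 [v2 [Bz v12 B1 B2]]]].
  have [p [pm pA]] := invariant_parent_map AG eAP Bz v12 B1 B2.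
  by exists p; split=> //; left.
have [p [pm pA]] : exists p, is_parent_map p /\
    forall u v, A (v, u) <-> p v = u.
  apply: (@invariant_parent_map (fun u v => A (v, u)) a z v1 v2) => //.
    by move=> h u v Gh; apply: AG.
  by move=> u v; rewrite eAP; split=> -[]; auto.
by exists p; split=> //; right.
Qed.

Lemma iter_parent_map p n g x :
  is_parent_map p -> G g -> g (iter n p x) = iter n p (g x).
Proof. by move=> [pG _ _] Gg; elim: n => //= n IHn; rewrite pG// IHn. Qed.

Lemma parent_map_aperiodic p x n : is_parent_map p -> iter n.+1 p x <> x.
Proof.
move=> pm px; have [_ _ [y [z [yz pyz]]]] := pm; apply: yz.
have per u : iter n.+1 p u = u.
  by have [g Gg <-] := G_vertex x u; rewrite -iter_parent_map// px.
by rewrite -(per y) -(per z) !iterSr pyz.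
Qed.

(** The lowest vertex determines the rest: it is the last one if arcs run from parent to child, the
    first one otherwise. *)
Lemma parent_map_highly_arc_transitive p A : is_parent_map p ->
  (forall u v, A (u, v) <-> p v = u) \/ (forall u v, A (u, v) <-> p u = v) ->
  highly_arc_transitive A G.
Proof.
move=> pm Ap s t u [At _] [Au _].
suff [g Gg gtu] : exists2 g, G g & forall i, g (tnth t i) = tnth u i.
  by exists g => //; apply: eq_from_tnth => i; rewrite tnth_map.
case: Ap => Ap.
  have down (w : s.+1.-tuple V) : (forall i j : 'I_s.+1, j = i.+1 :> nat ->
      A (tnth w i, tnth w j)) ->
      forall i, tnth w i = iter (s - i) p (tnth w ord_max).
    move=> Aw i; have [k ki] : exists k, k = s - i by exists (s - i).
    rewrite -ki; elim: k i ki => [|k IHk] i ki.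
      by congr tnth; apply: val_inj => /=; have := ltn_ord i; lia.
    have si : i.+1 < s.+1 by lia.
    have /Ap <- := Aw i (Ordinal si) erefl.
    by rewrite (IHk (Ordinal si))//=; lia.
  have [g Gg gE] := G_vertex (tnth t ord_max) (tnth u ord_max).
  by exists g => // i; rewrite (down t)// (down u)// iter_parent_map// gE.
have up (w : s.+1.-tuple V) : (forall i j : 'I_s.+1, j = i.+1 :> nat ->
    A (tnth w i, tnth w j)) -> forall i, tnth w i = iter i p (tnth w ord0).
  move=> Aw [i si]; elim: i si => [|i IHi] si /=.
    by congr tnth; apply: val_inj.
  have si' : i < s.+1 by lia.
  have /Ap <- := Aw (Ordinal si') (Ordinal si) erefl.
  by rewrite IHi.
have [g Gg gE] := G_vertex (tnth t ord0) (tnth u ord0).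
by exists g => // i; rewrite (up t)// (up u)// iter_parent_map// gE.
Qed.

End ArcOrbit.

Theorem theorem3p3 (V : choiceType) (e : rel V) (G : set (V -> V))
  (e_simple : simple_graph e)
  (e_connected : connected_graph e)
  (e_trivalent : trivalent e)
  (G_aut : aut_subgroup e G)
  (G_vertex : vertex_transitive G)
  (G_edge : edge_transitive e G)
  (G_not_arc : ~ arc_transitive e G)
  (G_stab : forall x : V, infinite_set (stab G x)) :
  [/\ tree e,
      (forall A : set (V * V), arc_orbit e G A -> highly_arc_transitive A G) &
      (exists w : set (nat -> V),
        [/\ graph_end e w,
            (forall g : V -> V, G g -> on_end g w = w) &
            (closed_group G ->
             forall w1 w2 : set (nat -> V),
               graph_end e w1 -> graph_end e w2 -> w1 <> w -> w2 <> w ->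
               exists2 g : V -> V, G g & on_end g w1 = w2)])].
Proof.
have orbitP A : arc_orbit e G A -> exists p, is_parent_map e G p /\
    ((forall u v, A (u, v) <-> p v = u) \/ (forall u v, A (u, v) <-> p u = v)).
  exact: arc_orbit_parent_map.
have [x0 _] := e_connected.1.
(* The orbit of any arc at [x0] yields the [p] used for the tree and its ends; for high
   arc-transitivity each orbit brings its own map. *)
have [p pm] : exists p, is_parent_map e G p.
  have [y [z [t [_ _ _ nP]]]] := trivalent_neighbours e_trivalent x0.
  have [|p [pm _]] := orbitP [set on_arc g (x0, y) | g in G]; last by exists p.
  by exists (x0, y) => //; apply/nP; left.
have aper x n := @parent_map_aperiodic _ _ _ G_vertex p x n pm.
have [_ eP _] := pm.
have [Ga _ _ Ginv] := G_aut.
have on_endE g r : G g -> ray e r -> on_end g (end_of e r) = end_of e (g \o r).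
  move=> Gg; have [h [Gh _ hg]] := Ginv g Gg.
  by apply: (on_end_of eP aper e_connected) hg; exact: Ga.
split.
- by split=> //; exact: acyclic_parent eP aper.
- move=> A /orbitP[q [qm qA]].
  exact: parent_map_highly_arc_transitive qm qA.
pose r0 n := iter n p x0; have rr0 : ray e r0 := ray_iter eP aper x0.
exists (end_of e r0); split.
- by exists r0.
- move=> g Gg; rewrite on_endE//; apply: (eq_end_of eP aper) => //.
    by apply: aut_ray => //; exact: Ga.
  (* As [g] commutes with [p], the ray [g \o r0] is again ascending. *)
  apply: (ascending_tail_equiv eP) => // n /=.
  by rewrite /r0 (iter_parent_map n _ pm).
have end_descending w : graph_end e w -> w <> end_of e r0 ->
    exists r, [/\ ray e r, w = end_of e r & descending_from p 0 r].
  move=> [r rr ->] wr0.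
  case: (ray_ascending_or_descending eP rr) => [up|[N dn]].
    case: wr0; apply: (eq_end_of eP aper) => //.
    exact: ascending_tail_equiv eP _ _ _ up _.
  (* Dropping the first [N] vertices keeps the end and makes the ray descend from its start. *)
  exists (fun k => r (N + k)); split; first exact: ray_shift.
    apply: (eq_end_of eP aper) => //; first exact: ray_shift.
    exact: tail_equiv_shift.
  by move=> n _; rewrite addnS dn// leq_addr.
move=> Gcl w1 w2 e1 e2 w1n w2n.
have [a [ra -> da]] := end_descending _ e1 w1n.
have [b [rb -> db]] := end_descending _ e2 w2n.
have exg k : exists g, G g /\ g (a k) = b k.
  by have [g] := G_vertex (a k) (b k); exists g.
have [gs gsP] := choice exg.
have gsab i k : i <= k -> gs k (a i) = b i.
  move=> ik; have [Gk gab] := gsP k.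
  rewrite -(@iter_descending _ _ _ _ i (k - i) da)// subnKC//.
  rewrite (iter_parent_map _ _ pm)// gab -{2}(subnKC ik).
  exact: iter_descending db _.
have e_fin x : finite_set [set y | e x y] by apply/finite_setP; exists 3.
(* Every [gs k] sends [a 0] to [b 0], the base pair that compactness requires. *)
have [g Gg gE] := closed_group_cluster e_connected e_fin G_aut Gcl
  (fun k => (gsP k).1) (fun k => gsab 0 k (leq0n k)).
exists g => //; rewrite on_endE//; congr end_of; apply: funext => i /=.
by apply: gE; exists i => k; exact: gsab.
Qed.
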